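(* Let $n$ be a positive integer, let $k$ be any fixed positive integer, and let $G$ be a nilpotent group of order $n$. Then $\psi_k(G)$ is minimum among all nilpotent groups of order $n$ (that is, $\psi_k(G)\le \psi_k(H)$ for every nilpotent group $H$ of order $n$) if and only if, for each prime $p$ dividing $n$, the Sylow $p$-subgroup of $G$ has prime exponent.
   Context: For a finite group $G$ and a positive integer $k$, $\psi_k(G)=\sum_{g\in G} o(g)^k$, where $o(g)$ denotes the order of the element $g$. The exponent of a finite group $G$ is the smallest positive integer $x$ such that $g^x$ is the identity for all $g\in G$. *)

(* Defs.v *)
From mathcomp Require Import all_boot all_fingroup all_solvable.

Set Implicit Arguments.
Unset Strict Implicit.
Unset Printing Implicit Defensive.

Definition psi (k : nat) (gT : finGroupType) (A : {set gT}) : nat :=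
  \sum_(g in A) #[g]%g ^ k.

(* [exponent A] is the library's lcm of the orders of the elements of [A];
   it is the least positive [x] that kills [A]. *)
Lemma exponent_least (gT : finGroupType) (A : {group gT}) :
  [/\ 0 < exponent A,
      forall g, g \in A -> (g ^+ exponent A = 1)%g
    & forall x, 0 < x -> (forall g, g \in A -> (g ^+ x = 1)%g) ->
        exponent A <= x].
Proof.
split; first exact: exponent_gt0.
- by move=> g Ag; apply: expg_exponent.
- by move=> x x_gt0 Ax; apply: dvdn_leq => //; apply/exponentP.
Qed.

(* Main.v *)
(** A nilpotent group is the direct product of its Sylow subgroups, and [psi k]
    is multiplicative on coprime direct products.  A nontrivial element of a
    [p]-group [P] has order at least [p], so
    [psi k P >= 1 + (#|P| - 1) * p ^ k], with equality exactly when every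
    nontrivial element has order [p].  The product of these bounds depends only
    on [n], and is attained by a direct product of groups of prime order. *)

Require Import Defs.
From mathcomp Require Import all_boot all_fingroup all_solvable.
From mathcomp Require Import zmodp.

Lemma leqif_prod (I : eqType) (r : seq I) (E1 E2 : I -> nat) (C : pred I) :
  {in r, forall i, 0 < E2 i} ->
  {in r, forall i, E1 i <= E2 i ?= iff C i} ->
  \prod_(i <- r) E1 i <= \prod_(i <- r) E2 i ?= iff all C r.
Proof.
elim: r => [|i r IHr] E2gt0 leE12; first by rewrite !big_nil.
have E2r : {in r, forall j, 0 < E2 j}.
  by move=> j rj; apply: E2gt0; rewrite inE rj orbT.
have leEr : {in r, forall j, E1 j <= E2 j ?= iff C j}.
  by move=> j rj; apply: leE12; rewrite inE rj orbT.
rewrite !big_cons /=.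
have := leqif_mul (leE12 i (mem_head i r)) (IHr E2r leEr).
(* [leqif_mul] also allows equality when the larger product is 0; positivity of [E2] rules that case
   out. *)
suff /lt0n_neq0/negPf-> : 0 < E2 i * \prod_(j <- r) E2 j by [].
by rewrite muln_gt0 E2gt0 ?mem_head //= big_seq prodn_cond_gt0.
Qed.

(** Commuting elements of coprime orders have the product of their orders as order, so the sum over
    [G] factors as a double sum over [H] and [K]. *)
Lemma psi_dprod (k : nat) (gT : finGroupType) (H K G : {group gT}) :
  (H \x K)%g = G -> coprime #|H| #|K| -> psi k G = psi k H * psi k K.
Proof.
move=> defG coHK; have [_ defHK cHK tiHK] := dprodP defG.
rewrite /psi big_distrlr /= pair_big /=.
rewrite (reindex_onto (fun u : gT * gT => u.1 * u.2)%g
  (fun x => (divgr H K x, remgr H K x))) /=; last first.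
  by move=> x Gx; rewrite -divgr_eq.
have injHK u : u.1 \in H -> u.2 \in K ->
  ((divgr H K (u.1 * u.2), remgr H K (u.1 * u.2)) = u)%g.
  by case: u => x y /= Hx Ky; rewrite remgrMid // divgrMid.
apply: eq_big => [u|u /andP[Gu /eqP def_u]].
  apply/andP/andP=> [[Gu /eqP <-]|[Hu Ku]].
    by rewrite mem_divgr ?mem_remgr // defHK.
  by rewrite injHK // -defHK mem_mulg.
have [Hu Ku] : u.1 \in H /\ u.2 \in K.
  by rewrite -def_u mem_divgr ?mem_remgr // defHK.
rewrite -expnMn orderM //; first exact: commute_sym (centsP cHK _ Ku _ Hu).
by apply: coprime_dvdl (coprime_dvdr _ coHK); rewrite order_dvdG.
Qed.

Lemma psi_nilpotent (k : nat) (gT : finGroupType) (G : {group gT}) :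
  nilpotent G -> psi k G = \prod_(p <- primes #|G|) psi k 'O_(p : nat)(G)%g.
Proof.
move=> nilG; rewrite -[in LHS](pcore_pgroup_id (pgroup_pi G)).
(* [G] is its own core for the primes dividing its order. Writing that set as a list allows an
   induction that splits off one Sylow factor at a time. *)
have -> : 'O_\pi(G)(G)%g = 'O_[pred p | p \in primes #|G|](G)%g by [].
elim: (primes #|G|) (primes_uniq #|G|) => [_|p s IHs /= /andP[sp us]].
  rewrite big_nil (card1_trivg (G := 'O_[pred _ | _](G)%G)).
    by rewrite /psi big_set1 order1 exp1n.
  by apply: pnat_1 (pcore_pgroup _ _) _; apply/pnatP=> // q.
rewrite big_cons -IHs //; set K := 'O__(G)%g.
have nilK : nilpotent K := nilpotentS (pcore_sub _ _) nilG.
have OpK : 'O_p(K)%g = 'O_p(G)%g.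
  rewrite -pcoreI; apply: eq_pcore => q; rewrite !inE.
  by case: eqP.
have Op'K : 'O_p^'(K)%g = 'O_[pred q | q \in s](G)%g.
  rewrite -pcoreI; apply: eq_pcore => q; rewrite !inE.
  by case: eqP => // ->; rewrite (negPf sp).
rewrite -OpK -Op'K; apply: psi_dprod (nilpotent_pcoreC p nilK) _.
exact: pnat_coprime (pcore_pgroup _ _) (pcore_pgroup _ _).
Qed.

(** The trivial group must be excluded: it attains the bound, but its exponent 1 is not prime. *)
Lemma leqif_psi_pgroup (k p : nat) (gT : finGroupType) (P : {group gT}) :
  0 < k -> prime p -> (p.-group P)%g -> P :!=: 1%g ->
  1 + #|P|.-1 * p ^ k <= psi k P ?= iff prime (exponent P).
Proof.
move=> k_gt0 p_pr pP ntP.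
(* Both the bound and the equality condition are spread over the elements of [P], so that
   [leqif_sum] can compare term by term. *)
have -> : 1 + #|P|.-1 * p ^ k =
    \sum_(x in P) (if x == 1%g then 1 else p ^ k).
  rewrite (bigD1 1%g) //= eqxx; congr (_ + _).
  rewrite (eq_bigr (fun=> p ^ k)) => [|x /andP[_ /negPf->]] //.
  rewrite sum_nat_const; congr (_ * _).
  rewrite (cardD1 1%g P) group1; apply: eq_card => x.
  by rewrite !inE andbC.
have p_dv x : x \in P -> x != 1%g -> p %| #[x]%g.
  move=> Px ntx.
  have px : (p.-elt x)%g := mem_p_elt pP Px.
  by have [] := pgroup_pdiv px _; rewrite ?cycle_eq1.
have -> : prime (exponent P) =
    [forall x in P, (x == 1%g) || (#[x]%g == p)].
  apply/idP/forall_inP=> [e_pr x Px|oP].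
    case: eqP => //= /eqP/(p_dv x Px) pdvx.
    have expp : exponent P = p.
      apply/esym/eqP; rewrite -dvdn_prime2 //.
      exact: dvdn_trans pdvx (dvdn_exponent Px).
    by rewrite eqn_dvd pdvx -{1}expp dvdn_exponent.
  suff -> : exponent P = p by [].
  apply/eqP; rewrite eqn_dvd; apply/andP; split.
    apply/exponentP=> x Px; apply/eqP; rewrite -order_dvdn.
    by have /orP[/eqP->|/eqP->] := oP x Px; rewrite ?order1 ?dvd1n.
  have [x Px ntx] := trivgPn _ ntP.
  exact: dvdn_trans (p_dv x Px ntx) (dvdn_exponent Px).
apply: leqif_sum => x Px; case: eqP => [->|/eqP ntx] /=.
  by rewrite order1 exp1n; apply/leqif_refl.
(* Since [k] is positive, equal [k]-th powers mean equal orders. *)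
split; last by rewrite eqn_exp2r // eq_sym.
by rewrite leq_exp2r // dvdn_leq ?p_dv.
Qed.

Definition psi_min (k n : nat) : nat :=
  \prod_(p <- primes n) (1 + (n`_p).-1 * p ^ k).

(** In a nilpotent group ['O_p(G)] is the unique Sylow [p]-subgroup. A boolean form is needed for
    the equality case of [leqif]. *)
Definition sylow_prime_exponent {gT : finGroupType} (G : {group gT}) : bool :=
  all (fun p : nat => prime (exponent 'O_p(G)%g)) (primes #|G|).

Lemma leqif_psi (k : nat) (gT : finGroupType) (G : {group gT}) :
  0 < k -> nilpotent G ->
  psi_min k #|G| <= psi k G ?= iff sylow_prime_exponent G.
Proof.
move=> k_gt0 nilG; rewrite psi_nilpotent //.
apply: leqif_prod => p; rewrite mem_primes => /and3P[p_pr _ p_dv].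
  rewrite /psi (bigD1 1%g) ?group1 //= order1 exp1n //.
rewrite -(card_Hall (nilpotent_pcore_Hall p nilG)).
apply: leqif_psi_pgroup => //; first exact: pcore_pgroup.
rewrite -cardG_gt1 (card_Hall (nilpotent_pcore_Hall p nilG)).
by rewrite p_part_gt1 mem_primes p_pr p_dv cardG_gt0.
Qed.

Lemma sylow_prime_exponentP (gT : finGroupType) (G : {group gT}) :
  nilpotent G ->
  reflect (forall (p : nat) (P : {group gT}),
     prime p -> p %| #|G| -> (p.-Sylow(G) P)%g -> prime (exponent P))
   (sylow_prime_exponent G).
Proof.
move=> nilG; apply: (iffP allP) => [eG p P p_pr p_dv sylP|eG p].
  rewrite (nilpotent_Hall_pcore nilG sylP).
  by apply: eG; rewrite mem_primes p_pr p_dv cardG_gt0.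
rewrite mem_primes => /and3P[p_pr _ p_dv].
by apply: eG p_dv _ => //; apply: nilpotent_pcore_Hall.
Qed.

(* The product over [p <= n] of [logn p n] copies of Z/p: primes not dividing
   [n] and non-primes occur with multiplicity 0. *)
Definition elementary_factors (n : nat) : finGroupType :=
  {dffun forall i : {p : 'I_n.+1 & 'I_(logn p n)}, 'I_(tag i).-1.+1}.

Lemma card_elementary_factors (n : nat) :
  0 < n -> #|[set: elementary_factors n]| = n.
Proof.
move=> n_gt0; rewrite cardsT card_dep_ffun foldrE big_map big_enum /=.
rewrite -[RHS](partnT n_gt0) /partn big_mkord.
transitivity (\prod_(p < n.+1) \prod_(j < logn p n) p.-1.+1).
  by rewrite sig_big_dep /=; apply: eq_bigr => i _; rewrite card_ord.
apply: eq_bigr => p _; rewrite prod_nat_const card_ord.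
(* Only at index 0 does [p.-1.+1] differ from [p], and there the exponent [logn 0 n] is 0. *)
by case: (val p) => [|q] //; rewrite lognE.
Qed.

(** Each coordinate lies in a cyclic group of order some prime divisor of [n], so the radical of [n]
    kills it. *)
Lemma exponent_elementary_factors (n : nat) (x : elementary_factors n) :
  (x ^+ (\prod_(p <- primes n) p)%N = 1)%g.
Proof.
have xX m i : ((x ^+ m) i = x i ^+ m)%g.
  by elim: m => [|m IHm]; rewrite ?expg0 ?oneg_ffun // !expgS mulg_ffun IHm.
apply/ffunP=> i; rewrite oneg_ffun xX; apply/eqP; rewrite -order_dvdn.
case: i => p j /=.
(* The mere existence of [j] in ['I_(logn p n)] makes [logn p n] positive. *)
have p_primes : val p \in primes n.
  by rewrite -logn_gt0; apply: leq_ltn_trans (ltn_ord j).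
apply: dvdn_trans (_ : val p %| _); last by rewrite (big_rem _ p_primes) dvdn_mulr.
have := order_dvdG (in_setT (x (existT _ p j))).
rewrite cardsT card_ord /= prednK //.
by rewrite mem_primes in p_primes; case/and3P: p_primes => /prime_gt0.
Qed.

Lemma abelian_elementary_factors (n : nat) :
  abelian [set: elementary_factors n].
Proof.
apply/centsP=> x _ y _; apply/ffunP=> i; rewrite !mulg_ffun.
exact: Zp_mulgC.
Qed.

(** The exponent of a Sylow [p]-subgroup is a power of [p] dividing the squarefree radical of [n],
    hence divides [p]; it is divisible by [p] because the subgroup is nontrivial. *)
Lemma sylow_prime_exponent_elementary_factors (n : nat) :
  0 < n -> sylow_prime_exponent [set: elementary_factors n]%G.
Proof.
move=> n_gt0; have oH := card_elementary_factors n n_gt0.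
apply/(sylow_prime_exponentP _ _ (abelian_nil (abelian_elementary_factors n))).
move=> p P p_pr; rewrite oH => p_dv sylP.
have np : p \in primes n by rewrite mem_primes p_pr n_gt0.
suff -> : exponent P = p by [].
apply/eqP; rewrite eqn_dvd; apply/andP; split.
  have : exponent P %| \prod_(q <- primes n) q.
    by apply/exponentP=> x _; apply: exponent_elementary_factors.
  rewrite (bigD1_seq p) ?primes_uniq //= Gauss_dvdl //.
  apply: (pnat_coprime (pi := p)).
    by rewrite pnat_exponent; apply: pHall_pgroup sylP.
  rewrite big_seq_cond; elim/big_ind: _ => // [a b pa pb|q].
    by rewrite pnatM pa.
  by rewrite mem_primes => /andP[/and3P[q_pr _ _] qp]; rewrite pnatE.
have : p \in \pi(P).
  rewrite -[_ \in _]/(p \in primes #|P|) (card_Hall sylP) oH.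
  by rewrite primes_part mem_filter np inE /= eqxx.
by rewrite -pi_of_exponent mem_primes => /and3P[].
Qed.

Theorem theorem1p3 (n k : nat) (n_gt0 : 0 < n) (k_gt0 : 0 < k)
    (gT : finGroupType) (G : {group gT}) (nilG : nilpotent G)
    (oG : #|G| = n) :
  (forall (hT : finGroupType) (H : {group hT}),
     nilpotent H -> #|H| = n -> psi k G <= psi k H)
  <->
  (forall (p : nat) (P : {group gT}),
     prime p -> p %| n -> (p.-Sylow(G) P)%g -> prime (exponent P)).
Proof.
subst n; have leG := leqif_psi k _ G k_gt0 nilG.
split=> [minG|eG hT H nilH oH].
  apply/sylow_prime_exponentP => //; rewrite -leG eqn_leq leG /=.
  set n := #|G| in n_gt0 leG minG *.
  have nilE := abelian_nil (abelian_elementary_factors n).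
  have oE := card_elementary_factors n n_gt0.
  (* Comparison with a group of order [n] that attains [psi_min] forces [psi k G] down to the lower
     bound, where the equality case applies. *)
  apply: leq_trans (minG _ [set: elementary_factors n]%G nilE oE) _.
  have attained := sylow_prime_exponent_elementary_factors n n_gt0.
  have := leqif_psi k _ [set: elementary_factors n]%G k_gt0 nilE.
  rewrite oE => -[_ eqE]; rewrite -eqE in attained.
  by rewrite (eqP attained).
have attained : psi_min k #|G| == psi k G.
  by rewrite leG; apply/sylow_prime_exponentP.
by rewrite -(eqP attained) -oH; apply: leqif_psi.
Qed.
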